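(* Let $N\ge 7$ be an integer, $h>0$, and let $T_{\epsilon,\sigma}$ and $T_M$ be the $N\times N$ matrices defined in the context. If $\sigma+\epsilon=1$ and $1<\sigma\le\frac{104\sqrt2}{79}-\frac{12}{79}$, then $T_M$ and $T_{\epsilon,\sigma}$ are monotone matrices.
   Context: The matrix $T_{\epsilon,\sigma}$ is the stiffness matrix of the cell centered Galerkin (CCG) discretization, with barycentric trace reconstruction, of $-u''=f$ on an interval with homogeneous Dirichlet conditions, on a uniform mesh of $N$ cells of size $h$. Explicitly, with real parameters $\epsilon$ and $\sigma$, put $$a=\tfrac{5\sigma}{4}-\tfrac{\epsilon}{4}+\tfrac34,\quad b=\tfrac{\epsilon}{16}-\tfrac{15\sigma}{16}-\tfrac1{16},\quad c=\tfrac{\epsilon}{8}+\tfrac{3\sigma}{8}-\tfrac38,\quad d=\tfrac1{16}-\tfrac{\sigma}{16}-\tfrac{\epsilon}{16},$$ $$a_1=\tfrac{5\sigma}{4}-\tfrac{3\epsilon}{16}+\tfrac{11}{16},\quad a_0=\tfrac{13\sigma}{8}-\tfrac{5\epsilon}{16}+\tfrac{13}{16},\quad b_0=\tfrac5{16}-\tfrac{9\sigma}{8}-\tfrac{\epsilon}{16},\quad c_0=\tfrac{3\epsilon}{16}+\tfrac{7\sigma}{16}-\tfrac7{16}.$$ Then $T_{\epsilon,\sigma}=\frac1h M$, where $M$ is the $N\times N$ matrix with entries (indices $1\le i,j\le N$): - $M_{ii}=a_0$ if $i\in\{1,N\}$, $M_{ii}=a_1$ if $i\in\{2,N-1\}$,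 and $M_{ii}=a$ otherwise; - if $|i-j|=1$: $M_{ij}=b_0$ when $\{i,j\}=\{1,2\}$ or $\{i,j\}=\{N-1,N\}$, and $M_{ij}=b$ otherwise; - if $|i-j|=2$: $M_{ij}=c_0$ when $\{i,j\}=\{1,3\}$ or $\{i,j\}=\{N-2,N\}$, and $M_{ij}=c$ otherwise; - if $|i-j|=3$: $M_{ij}=d$; - if $|i-j|\ge4$: $M_{ij}=0$. Put $A=\max\{a_0,a_1,a\}$, $B=\max\{b_0,b\}$, $C=\max\{c_0,c\}$. The matrix $T_M$ is the $N\times N$ symmetric banded Toeplitz matrix with $(T_M)_{ij}=A$ if $i=j$, $B$ if $|i-j|=1$, $C$ if $|i-j|=2$, $d$ if $|i-j|=3$, and $0$ if $|i-j|\ge4$. A real square matrix is monotone if it is nonsingular and its inverse is entrywise nonnegative. *)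

(* Defs.v *)
From mathcomp Require Import all_boot all_order all_algebra.
From mathcomp Require Import reals.

Set Implicit Arguments.
Unset Strict Implicit.
Unset Printing Implicit Defensive.

Import Order.TTheory GRing.Theory Num.Theory.
Local Open Scope ring_scope.

Definition monotone_mx (R : realType) (n : nat) (X : 'M[R]_n) : Prop :=
  X \in unitmx /\ forall i j : 'I_n, 0 <= invmx X i j.

Section Coefficients.
Variables (R : realType) (eps sigma : R).

Definition coef_a : R := 5 * sigma / 4 - eps / 4 + 3 / 4.
Definition coef_b : R := eps / 16 - 15 * sigma / 16 - 1 / 16.
Definition coef_c : R := eps / 8 + 3 * sigma / 8 - 3 / 8.
Definition coef_d : R := 1 / 16 - sigma / 16 - eps / 16.
Definition coef_a1 : R := 5 * sigma / 4 - 3 * eps / 16 + 11 / 16.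
Definition coef_a0 : R := 13 * sigma / 8 - 5 * eps / 16 + 13 / 16.
Definition coef_b0 : R := 5 / 16 - 9 * sigma / 8 - eps / 16.
Definition coef_c0 : R := 3 * eps / 16 + 7 * sigma / 16 - 7 / 16.

Definition coef_A : R := Num.max (Num.max coef_a0 coef_a1) coef_a.
Definition coef_B : R := Num.max coef_b0 coef_b.
Definition coef_C : R := Num.max coef_c0 coef_c.

End Coefficients.

(* {p, q} = {x, y} as unordered pairs *)
Definition same_pair (p q x y : nat) : bool :=
  ((p == x) && (q == y)) || ((p == y) && (q == x)).

Definition dist (p q : nat) : nat := `|p - q|%N.

(* The indices p, q run over 1, ..., N. *)
Definition M_entry (R : realType) (eps sigma : R) (N p q : nat) : R :=
  match dist p q with
  | 0 => if (p == 1%N) || (p == N) then coef_a0 eps sigma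
         else if (p == 2%N) || (p == N.-1) then coef_a1 eps sigma
         else coef_a eps sigma
  | 1 => if same_pair p q 1 2 || same_pair p q N.-1 N then coef_b0 eps sigma
         else coef_b eps sigma
  | 2 => if same_pair p q 1 3 || same_pair p q N.-2 N then coef_c0 eps sigma
         else coef_c eps sigma
  | 3 => coef_d eps sigma
  | _ => 0
  end.

(* 'I_N is 0-based, hence the successors. *)
Definition T_mx (R : realType) (h eps sigma : R) (N : nat) : 'M[R]_N :=
  h^-1 *: \matrix_(i < N, j < N) M_entry eps sigma N i.+1 j.+1.

Definition TM_mx (R : realType) (eps sigma : R) (N : nat) : 'M[R]_N :=
  \matrix_(i < N, j < N)
    match dist i j with
    | 0 => coef_A eps sigma
    | 1 => coef_B eps sigma
    | 2 => coef_C eps sigma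
    | 3 => coef_d eps sigma
    | _ => 0
    end.

(* Main.v *)
Require Import Defs.
From mathcomp Require Import all_boot all_order all_algebra.
From mathcomp Require Import reals.
From mathcomp Require Import ring lra zify.

Import Order.TTheory GRing.Theory Num.Theory.
Local Open Scope ring_scope.

(** With [eps = 1 - sigma] the coefficient [d] vanishes, so both matrices are
    pentadiagonal; their outer diagonal [(sigma - 1) / 4] is positive, so neither
    is an M-matrix.

    The matrix [T_M] is Toeplitz with entries [A], [B], [C].  Its symbol factors as
    [C (y1 - z)(y2 - z)] with [z = x + 1/x], where the [y]'s are the roots of
    [C y^2 + B y + (A - 2 C)].  Here the discriminant is, up to a positive factor,
    [272 - 24 sigma - 79 sigma^2], and it is nonnegative exactly up to the bound
    assumed on [sigma]; both roots are then at least [2].  Hence [T_M u = f] says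
    that [u], extended by two zeros on each side, solves [S1 (S2 u) = f], where
    [S_i w = y_i w_k - w_(k-1) - w_(k+1)]: a discrete clamped beam.  Truncation
    keeps [T_M] from being the product [C S1 S2] of two tridiagonal M-matrices, and
    positivity comes instead from a sign argument ([clamped_nonneg]).  If [f >= 0]
    then [v = S2 u] obeys a minimum principle, so the places where [v > 0] lie in an
    interval on which [v >= 0], and [v <= 0] outside it.  Outside the interval [u]
    is convex wherever it is nonnegative and starts with zero value and zero slope,
    so it is nonnegative; inside, [u] itself obeys the minimum principle.  This
    gives [penta_monotone].

    The stiffness matrix [M] (with [T = M / h]) is entrywise at most [T_M], and such
    a matrix is monotone as soon as it maps one positive vector to a positive
    vector ([monotone_comparison]).  The vector is the concave parabola vanishing at
    the two ends of the interval, sampled at cell centers: [M] is consistent with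
    [-u''] in the interior, and its boundary rows annihilate the linear functions
    vanishing at the boundary face, so that only the quadratic part contributes,
    with the right sign ([M_parabola_gt0]). *)

(** * Positivity for the discrete clamped beam *)

(** For [2 <= y] the inequality makes [w] concave wherever it is nonpositive:
    once [w] drops below zero it keeps decreasing, and cannot be nonnegative at
    the right end. *)
Lemma minimum_principle (R : realFieldType) (y : R) (w : nat -> R) (p q : nat) :
  2 <= y -> 0 <= w p -> 0 <= w q ->
  (forall k, (p <= k)%N -> (k.+2 <= q)%N -> w k + w k.+2 <= y * w k.+1) ->
  forall k, (p <= k <= q)%N -> 0 <= w k.
Proof.
move=> hy hp hq hw k.
elim: k => [|k IH] /andP[pk kq]; first by move: pk hp; rewrite leqn0 => /eqP ->.
have [<-//|pk'] : p = k.+1 \/ (p <= k)%N by lia.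
have wk : 0 <= w k by apply: IH; lia.
case: (lerP 0 (w k.+1)) => // wk1.
suff desc j : (k + j < q)%N -> w (k + j).+1 < 0 /\ w (k + j).+1 < w (k + j)%N.
  have [] := desc (q - k.+1)%N ltac:(lia).
  have -> : (k + (q - k.+1)).+1 = q by lia.
  lra.
elim: j => [|j IHj] hj; first by rewrite addn0; lra.
have [h1 h2] := IHj ltac:(lia).
have := hw (k + j)%N ltac:(lia) ltac:(lia).
rewrite addnS; nra.
Qed.

(** For [2 <= y] the inequality makes [w] convex wherever it is nonnegative, so a
    nonnegative initial slope never decreases. *)
Lemma nonneg_of_growth (R : realFieldType) (y : R) (w : nat -> R) (q : nat) :
  2 <= y -> 0 <= w 0 -> w 0 <= w 1 ->
  (forall k, (k.+2 <= q)%N -> y * w k.+1 <= w k + w k.+2) ->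
  forall k, (k <= q)%N -> 0 <= w k.
Proof.
move=> hy h0 h1 hw.
suff incr k : (k < q)%N -> 0 <= w k /\ w k <= w k.+1.
  by case=> [//|k] /incr; lra.
elim: k => [//|k IH] hk.
have [h2 h3] := IH ltac:(lia).
have := hw k hk; nra.
Qed.

(** The four zeros are the clamped boundary conditions, value and slope at each end.
    With [p] and [q] the first and last places where [v > 0], the growth lemma covers
    [w] up to [p.+1] and, by reflection, from [q.+1] on; the minimum principle,
    applied to [v] and then to [w], covers the middle. *)
Lemma clamped_nonneg (R : realFieldType) (y1 y2 : R) (n : nat) (w : nat -> R) :
  2 <= y1 -> 2 <= y2 ->
  w 0 = 0 -> w 1 = 0 -> w n.+2 = 0 -> w n.+3 = 0 ->
  let v k := y2 * w k.+1 - w k - w k.+2 in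
  (forall k, (k < n)%N -> v k + v k.+2 <= y1 * v k.+1) ->
  forall k, (k <= n.+3)%N -> 0 <= w k.
Proof.
move=> hy1 hy2 w0 w1 wn2 wn3 v hv.
(* [v k] is centered at [w k.+1], whence the shift by one in the ranges below. *)
have left_part q : (q < n.+3)%N -> (forall k, (k < q)%N -> v k <= 0) ->
    forall k, (k <= q.+1)%N -> 0 <= w k.
  move=> hq hvq; apply: (@nonneg_of_growth _ y2); rewrite ?w0 ?w1 // => k hk.
  have := hvq k ltac:(lia); rewrite /v; lra.
have right_part p : (forall k, (p < k <= n.+1)%N -> v k <= 0) ->
    forall k, (p.+1 <= k <= n.+3)%N -> 0 <= w k.
  move=> hvp k hk.
  have := @nonneg_of_growth _ y2 (fun j => w (n.+3 - j)%N) (n.+3 - p.+1) hy2.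
  move=> /(_ ltac:(by rewrite subn0 wn3)) /(_ ltac:(by rewrite subn0 wn3 subn1 wn2)).
  move=> H; have {H} := H _ (n.+3 - k)%N ltac:(lia).
  rewrite subKn; last lia.
  apply=> j hj.
  have := hvp (n.+3 - j.+2)%N ltac:(lia); rewrite /v.
  have -> : (n.+3 - j.+2).+1 = (n.+3 - j.+1)%N by lia.
  have -> : (n.+3 - j.+1).+1 = (n.+3 - j)%N by lia.
  lra.
case: (boolP [exists k : 'I_n.+2, 0 < v k]); last first.
  rewrite negb_exists => /forallP hneg.
  apply: left_part => // k hk.
  by have := hneg (Ordinal hk); rewrite /= -leNgt.
move=> /existsP[k0 hk0].
have ex : exists k, (k < n.+2)%N && (0 < v k) by exists k0; rewrite ltn_ord.
have ub k : (k < n.+2)%N && (0 < v k) -> (k <= n.+2)%N by move=> /andP[/ltnW].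
have [p /andP[hp vp] minp] := ex_minnP ex.
have [q /andP[hq vq] maxq] := ex_maxnP ex ub.
have pq : (p <= q)%N by apply: minp; rewrite hq.
have vpq k : (p <= k <= q)%N -> 0 <= v k.
  apply: (@minimum_principle _ y1) => //; try exact: ltW.
  by move=> j _ hj; apply: hv; lia.
have wl k : (k <= p.+1)%N -> 0 <= w k.
  apply: left_part => [|j hj]; first lia.
  rewrite leNgt; apply/negP => vj; have := minp j.
  by rewrite vj andbT => /(_ ltac:(lia)); lia.
have wr k : (q.+1 <= k <= n.+3)%N -> 0 <= w k.
  apply: right_part => j hj.
  rewrite leNgt; apply/negP => vj; have := maxq j.
  by rewrite vj andbT => /(_ ltac:(lia)); lia.
have wm k : (p.+1 <= k <= q.+1)%N -> 0 <= w k.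
  apply: (@minimum_principle _ y2) => //; first by apply: wl.
    by apply: wr; lia.
  move=> j hj1 hj2; have := vpq j ltac:(lia); rewrite /v; lra.
move=> k hk.
have [h|[h|h]] : (k <= p.+1)%N \/ (p.+1 <= k <= q.+1)%N \/ (q.+1 <= k <= n.+3)%N by lia.
- exact: wl.
- exact: wm.
- exact: wr.
Qed.

(** * Criteria for monotone matrices *)

(** Injectivity comes for free: if [X *m u = 0] then both [u] and [- u] are
    nonnegative. *)
Lemma monotone_of_inverse_positive (R : realType) (n : nat) (X : 'M[R]_n) :
  (forall u : 'cV[R]_n, (forall i, 0 <= (X *m u) i 0) -> forall i, 0 <= u i 0) ->
  monotone_mx X.
Proof.
move=> hX.
have unitX : X \in unitmx.
  rewrite -unitmx_tr -row_free_unit; apply: inj_row_free => v hv.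
  have hv' : X *m v^T = 0 by rewrite -[LHS]trmxK trmx_mul trmxK hv trmx0.
  apply/rowP => i; rewrite mxE; apply/eqP; rewrite eq_le; apply/andP; split.
    have := hX (- v^T) _ i; rewrite !mxE oppr_ge0; apply=> j.
    by rewrite mulmxN hv' !mxE oppr0.
  by have := hX v^T _ i; rewrite !mxE; apply=> j; rewrite hv' mxE.
split=> // i j.
have := hX (col j (invmx X)) _ i; rewrite mxE; apply=> k.
by rewrite colE mulmxA mulmxV // mul1mx mxE ler0n.
Qed.

(** Strictness survives because a row of an invertible matrix, here of the inverse
    of [B], cannot vanish. *)
Lemma monotone_pos (R : realType) (n : nat) (B : 'M[R]_n) (z : 'cV[R]_n) :
  monotone_mx B -> (forall i, 0 < (B *m z) i 0) -> forall i, 0 < z i 0.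
Proof.
move=> [unitB invB] hz i.
have zE : z i 0 = \sum_j invmx B i j * (B *m z) j 0.
  by rewrite -{1}[z](mulKmx unitB) mxE.
have ge0 j : true -> 0 <= invmx B i j * (B *m z) j 0.
  by move=> _; apply: mulr_ge0 => //; apply: ltW.
rewrite lt_def zE sumr_ge0 // andbT; apply/negP => /eqP /(psumr_eq0P ge0) h0.
have /matrixP/(_ i i) := mulVmx unitB.
rewrite !mxE eqxx big1 => [/eqP|j _]; first by rewrite eq_sym oner_eq0.
have /eqP := h0 j isT.
by rewrite mulf_eq0 (gt_eqF (hz j)) orbF => /eqP ->; rewrite mul0r.
Qed.

(** If [A *m w >= 0] while [w] has a negative entry, add to [w] the multiple of [u]
    that makes it nonnegative with one zero entry.  Then [B] maps the result [z] to
    [A *m z + (B - A) *m z > 0], so [z > 0], contradicting the zero entry. *)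
Lemma monotone_comparison (R : realType) (n : nat) (A B : 'M[R]_n) (u : 'cV[R]_n) :
  monotone_mx B -> (forall i j, A i j <= B i j) ->
  (forall i, 0 < u i 0) -> (forall i, 0 < (A *m u) i 0) ->
  monotone_mx A.
Proof.
move=> hB hAB hu hAu; apply: monotone_of_inverse_positive => w hw i.
rewrite leNgt; apply/negP => wi.
case: (@arg_minP _ R _ i xpredT (fun j => w j 0 / u j 0)) => // i0 _ hmin.
pose m := - (w i0 0 / u i0 0).
have m0 : 0 < m.
  rewrite oppr_gt0; apply: le_lt_trans (hmin i isT) _.
  by rewrite pmulr_llt0 ?invr_gt0.
have zge j : 0 <= (w + m *: u) j 0.
  rewrite !mxE mulNr subr_ge0 -ler_pdivlMr //; exact: hmin.
suff /(monotone_pos _ _ _ _ hB)/(_ i0) : forall j, 0 < (B *m (w + m *: u)) j 0.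
  by rewrite !mxE mulNr divfK ?gt_eqF // subrr ltxx.
move=> j.
have -> : B *m (w + m *: u) = A *m w + m *: (A *m u) + (B - A) *m (w + m *: u).
  by rewrite mulmxBl scalemxAr -mulmxDr [RHS]addrC subrK.
rewrite 2!mxE [(m *: (A *m u)) j 0]mxE; apply: ltr_wpDr.
  rewrite mxE; apply: sumr_ge0 => k _; apply: mulr_ge0 => //.
  by rewrite !mxE subr_ge0.
by apply: ltr_wpDl => //; rewrite mulr_gt0.
Qed.

Lemma monotone_scale (R : realType) (n : nat) (a : R) (X : 'M[R]_n) :
  0 < a -> monotone_mx X -> monotone_mx (a *: X).
Proof.
move=> a0 [unitX invX].
have unita : a \is a GRing.unit by rewrite unitfE gt_eqF.
split=> [|i j]; first by rewrite unitmxZ.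
rewrite invmxZ ?unitmxZ // mxE; apply: mulr_ge0 => //.
by rewrite invr_ge0 ltW.
Qed.

(** * Pentadiagonal Toeplitz matrices *)

(** Entry [j] of [g] is placed at [j + 2], between two zeros on each side: every row
    of a pentadiagonal matrix then sees the same five-term stencil. *)
Definition pad {R : realType} (n : nat) (g : nat -> R) (m : nat) : R :=
  if (1 < m < n.+2)%N then g (m - 2)%N else 0.

Lemma sum_band (R : realType) (n i : nat) (g : nat -> R) :
  (i < n)%N -> (forall j, (j < n)%N -> (2 < dist i j)%N -> g j = 0) ->
  \sum_(j < n) g j =
  pad n g i + pad n g i.+1 + pad n g i.+2 + pad n g i.+3 + pad n g i.+4.
Proof.
move=> hi hg.
have -> : \sum_(j < n) g j = \sum_(0 <= m < n.+4) pad n g m.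
  rewrite big_nat_recl // big_nat_recl // big_nat_recr //= big_nat_recr //=.
  have -> : pad n g n.+2 = 0 by rewrite /pad ltnn andbF.
  have -> : pad n g n.+3 = 0 by rewrite /pad ifF //; lia.
  rewrite [pad n g 0]/pad [pad n g 1]/pad /= !add0r !addr0 big_mkord.
  by apply: eq_bigr => j _; rewrite /pad !ltnS ltn_ord subn2.
have padE m : (m < n.+4)%N -> ~~ (i <= m < i + 5)%N -> pad n g m = 0.
  rewrite /pad => _ hm; case: ifP => // hm'; apply: hg; first lia.
  rewrite /dist; lia.
rewrite (@big_cat_nat _ _ _ i) /=; [|lia|lia].
rewrite (@big_cat_nat _ _ _ (i + 5) i) /=; [|lia|lia].
rewrite big_nat_cond big1 ?add0r; last by move=> m hm; apply: padE; lia.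
rewrite [X in _ + X]big_nat_cond [X in _ + X]big1 ?addr0; last first.
  by move=> m hm; apply: padE; lia.
rewrite -{1}[i]add0n big_addn addKn !big_nat_recr //= big_nil add0r.
by rewrite !add0n !add1n.
Qed.

Definition penta_mx {R : realType} (A B C : R) (n : nat) : 'M[R]_n :=
  \matrix_(i < n, j < n)
    match dist i j with 0 => A | 1 => B | 2 => C | _ => 0 end.

(** The third hypothesis says that the polynomial [C y^2 + B y + (A - 2 C)] is
    nonnegative at [y = 2], the second that its vertex is at least [2] and the last
    that its roots are real; together they make both roots at least [2]. *)
Lemma penta_monotone (R : realType) (A B C : R) (n : nat) :
  0 < C -> 4 * C <= - B -> 0 <= A + 2 * B + 2 * C ->
  4 * C * (A - 2 * C) <= B ^+ 2 ->
  monotone_mx (penta_mx A B C n).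
Proof.
move=> C0 hB h2 hD; apply: monotone_of_inverse_positive => u hu.
pose r := Num.sqrt (B ^+ 2 - 4 * C * (A - 2 * C)).
have r0 : 0 <= r by apply: sqrtr_ge0.
have r2 : r ^+ 2 = B ^+ 2 - 4 * C * (A - 2 * C) by rewrite sqr_sqrtr // subr_ge0.
have rle : r <= - B - 4 * C.
  rewrite -(@ler_pXn2r _ 2) ?nnegrE //; last lra.
  rewrite r2; nra.
pose y1 := (- B - r) / (2 * C); pose y2 := (- B + r) / (2 * C).
have hy1 : 2 <= y1 by rewrite /y1 ler_pdivlMr; lra.
have hy2 : 2 <= y2 by rewrite /y2 ler_pdivlMr; lra.
have C_neq0 : C != 0 by rewrite gt_eqF.
have hs : C * (y1 + y2) = - B by rewrite /y1 /y2; field.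
(* The extra [2] is the constant term of [(x + 1/x)^2]. *)
have hp : C * (y1 * y2 + 2) = A.
  have -> : y1 * y2 = (B ^+ 2 - r ^+ 2) / (4 * C ^+ 2).
    by rewrite /y1 /y2; field.
  by rewrite r2; field.
(* The entries of [u] as a sequence, for use with [pad]. *)
pose g j := if insub j is Some k then u k 0 else 0.
have gE (k : 'I_n) : g k = u k 0 by rewrite /g valK.
pose w := pad n g.
suff w_ge0 k : (k <= n.+3)%N -> 0 <= w k.
  move=> i; have := w_ge0 i.+2; rewrite /w /pad /= !ltnS ltn_ord subn2 gE.
  by apply; have := ltn_ord i; lia.
apply: (@clamped_nonneg _ y1 y2 n w) => //.
- by rewrite /w /pad ltnn andbF.
- by rewrite /w /pad ifF //; lia.
move=> {}k hk.
have := hu (Ordinal hk); rewrite mxE.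
pose f j := match dist k j with 0 => A | 1 => B | 2 => C | _ => 0 end * g j.
rewrite (eq_bigr (fun j : 'I_n => f j)); last by move=> j _; rewrite !mxE /= -gE.
rewrite (sum_band _ _ k) //; last first.
  by move=> j _; rewrite /f; case: (dist k j) => [|[|[|?]]] // _; rewrite mul0r.
have padf c m :
    match dist k (m - 2) with 0 => A | 1 => B | 2 => C | _ => 0 end = c \/ (m < 2)%N ->
    pad n f m = c * w m.
  move=> hc; rewrite /w /pad; case: ifP => hm; last by rewrite mulr0.
  by case: hc => [<-//|]; lia.
rewrite (padf C k) //; last first.
  case: (ltnP k 2) => [|h2k]; [by right|left].
  by have -> : dist k (k - 2) = 2%N by rewrite /dist; lia.
rewrite (padf B k.+1) //; last first.
  case: (ltnP k.+1 2) => [|h2k]; [by right|left].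
  by have -> : dist k (k.+1 - 2) = 1%N by rewrite /dist; lia.
rewrite (padf A k.+2) //; last first.
  by left; have -> : dist k (k.+2 - 2) = 0%N by rewrite /dist; lia.
rewrite (padf B k.+3) //; last first.
  by left; have -> : dist k (k.+3 - 2) = 1%N by rewrite /dist; lia.
rewrite (padf C k.+4) //; last first.
  by left; have -> : dist k (k.+4 - 2) = 2%N by rewrite /dist; lia.
move=> h; rewrite -subr_ge0 -(pmulr_rge0 _ C0).
apply: le_trans h _; rewrite le_eqVlt; apply/orP; left; apply/eqP.
rewrite -hp -[B]opprK -hs; ring.
Qed.

(** * The matrices of the discretization *)

Lemma coefsE (R : realType) (eps sigma : R) : sigma + eps = 1 ->
  [/\ coef_a eps sigma = (24 * sigma + 8) / 16,
      coef_a1 eps sigma = (23 * sigma + 8) / 16,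
      coef_a0 eps sigma = (31 * sigma + 8) / 16,
      coef_b eps sigma = - sigma
    & [/\ coef_b0 eps sigma = (4 - 17 * sigma) / 16,
      coef_c eps sigma = (sigma - 1) / 4,
      coef_c0 eps sigma = (sigma - 1) / 4
    & coef_d eps sigma = 0]].
Proof.
move=> h; have -> : eps = 1 - sigma by lra.
rewrite /coef_a /coef_a1 /coef_a0 /coef_b /coef_b0 /coef_c /coef_c0 /coef_d.
by split; [lra..|split; lra].
Qed.

(** The bound is the positive root of [79 s^2 + 24 s - 272], because
    [12^2 + 79 * 272 = 2 * 104^2]. *)
Lemma sigma_bound (R : realType) (sigma : R) : 1 < sigma ->
  sigma <= 104 * Num.sqrt 2 / 79 - 12 / 79 ->
  79 * sigma ^+ 2 + 24 * sigma <= 272.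
Proof.
move=> h1 h2.
have r2 : Num.sqrt (2 : R) ^+ 2 = 2 by rewrite sqr_sqrtr.
have r0 : 0 <= Num.sqrt (2 : R) by apply: sqrtr_ge0.
nra.
Qed.

Lemma sigma_lt2 (R : realType) (sigma : R) : 1 < sigma ->
  79 * sigma ^+ 2 + 24 * sigma <= 272 -> sigma < 2.
Proof. nra. Qed.

(** The maximum [B] is [b0] rather than [b] only for [sigma <= 4]; the present range
    of [sigma] is well inside. *)
Lemma TM_penta (R : realType) (eps sigma : R) (N : nat) :
  sigma + eps = 1 -> 1 < sigma < 2 ->
  TM_mx eps sigma N =
  penta_mx ((31 * sigma + 8) / 16) ((4 - 17 * sigma) / 16) ((sigma - 1) / 4) N.
Proof.
move=> hse hs; have [ha ha1 ha0 hb [hb0 hc hc0 hd]] := coefsE _ _ _ hse.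
have hA : coef_A eps sigma = (31 * sigma + 8) / 16.
  by rewrite /coef_A ha0 ha1 ha !max_l //; lra.
have hB : coef_B eps sigma = (4 - 17 * sigma) / 16.
  by rewrite /coef_B hb0 hb max_l //; lra.
have hC : coef_C eps sigma = (sigma - 1) / 4 by rewrite /coef_C hc0 hc maxxx.
apply/matrixP => i j; rewrite !mxE hA hB hC hd.
by case: (dist i j) => [|[|[|[|]]]].
Qed.

Lemma M_entry_le_TM (R : realType) (eps sigma : R) (N : nat) (i j : 'I_N) :
  M_entry eps sigma N i.+1 j.+1 <= TM_mx eps sigma N i j.
Proof.
rewrite mxE /M_entry.
have -> : dist i.+1 j.+1 = dist i j by rewrite /dist; lia.
rewrite /coef_A /coef_B /coef_C.
case: (dist i j) => [|[|[|[|?]]]] //.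
- by case: ifP => _; [|case: ifP => _]; rewrite !le_max lexx ?orbT.
- by case: ifP => _; rewrite !le_max lexx ?orbT.
- by case: ifP => _; rewrite !le_max lexx ?orbT.
Qed.

(** The function [t (N - t)] at the cell center [t = j + 1/2], in units of the mesh
    size. *)
Definition parabola {R : realType} (N j : nat) : R :=
  (j%:R + 1 / 2) * (N%:R - (j%:R + 1 / 2)).

Lemma parabola_gt0 (R : realType) (N j : nat) : (j < N)%N -> 0 < parabola N j :> R.
Proof.
move=> hj; have j0 : 0 <= j%:R :> R by rewrite ler0n.
have jN : j.+1%:R <= N%:R :> R by rewrite ler_nat.
rewrite -natr1 in jN; rewrite /parabola; apply: mulr_gt0; lra.
Qed.

(** On [t (N - t)] the linear part contributes nothing in any row, by symmetry in the
    interior and by the choice of the boundary coefficients near the ends; the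
    part [- t^2] gives [2] in the interior rows, [(22 sigma + 56) / 64] in the extreme
    rows and [(14 sigma + 120) / 64] in their neighbors. *)
Lemma M_parabola_gt0 (R : realType) (eps sigma : R) (N i : nat) :
  (7 <= N)%N -> sigma + eps = 1 -> 1 < sigma -> (i < N)%N ->
  0 < \sum_(j < N) M_entry eps sigma N i.+1 j.+1 * parabola N j.
Proof.
move=> hN hse hs hi.
have [ha ha1 ha0 hb [hb0 hc hc0 hd]] := coefsE _ _ _ hse.
pose f j := M_entry eps sigma N i.+1 j.+1 * parabola N j.
rewrite -[X in _ < X]/(\sum_(j < N) f j) (sum_band _ _ i) //; last first.
  move=> j _ hj; rewrite /f /M_entry.
  have -> : dist i.+1 j.+1 = dist i j by rewrite /dist; lia.
  by move: hj; case: (dist i j) => [|[|[|[|?]]]] // _; rewrite ?hd mul0r.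
(* In the padded sequence, index [m] stands for the cell numbered [m - 1]
   in the 1-based count of [M_entry]. *)
have pad0 m : ~~ (1 < m < N.+2)%N -> pad N f m = 0 by rewrite /pad => /negbTE ->.
have padE m c : (1 < m < N.+2)%N -> M_entry eps sigma N i.+1 m.-1 = c ->
    pad N f m = c * ((m%:R - 3 / 2) * (N%:R - (m%:R - 3 / 2))).
  move=> hm <-; rewrite /pad hm /f.
  have -> : (m - 2).+1 = m.-1 by lia.
  congr (_ * _); rewrite /parabola natrB; last lia.
  by field.
have entry2 q : dist i.+1 q = 2%N -> M_entry eps sigma N i.+1 q = (sigma - 1) / 4.
  by move=> e; rewrite /M_entry e hc hc0; case: ifP.
have entry1 q : (0 < q <= N)%N -> dist i.+1 q = 1%N -> M_entry eps sigma N i.+1 q =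
    if ((i == 0) || (q == 1) || (i == N.-1) || (q == N))%N
    then (4 - 17 * sigma) / 16 else - sigma.
  move=> hq e; rewrite /M_entry e hb hb0; congr (if _ then _ else _).
  by move: e; rewrite /same_pair /dist => e; lia.
have entry0 : M_entry eps sigma N i.+1 i.+1 =
    if ((i == 0) || (i == N.-1))%N then (31 * sigma + 8) / 16
    else if ((i == 1) || (i == N.-2))%N then (23 * sigma + 8) / 16
    else (24 * sigma + 8) / 16.
  rewrite /M_entry ha ha1 ha0.
  have -> : dist i.+1 i.+1 = 0%N by rewrite /dist; lia.
  by congr (if _ then _ else _); [lia|congr (if _ then _ else _); lia].
have padL2 : (2 <= i)%N -> pad N f i = 
    (sigma - 1) / 4 * ((i%:R - 3 / 2) * (N%:R - (i%:R - 3 / 2))).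
  by move=> h; apply: padE; [lia|apply: entry2; rewrite /dist; lia].
have padR2 : (i.+2 < N)%N -> pad N f i.+4 = 
    (sigma - 1) / 4 * ((i.+4%:R - 3 / 2) * (N%:R - (i.+4%:R - 3 / 2))).
  by move=> h; apply: padE; [lia|apply: entry2; rewrite /dist; lia].
have padL1 c : (1 <= i)%N -> c = (if ((i == 1) || (i == N.-1))%N
    then (4 - 17 * sigma) / 16 else - sigma) -> pad N f i.+1 = 
    c * ((i.+1%:R - 3 / 2) * (N%:R - (i.+1%:R - 3 / 2))).
  move=> h ->; apply: padE; first lia.
  by rewrite entry1; [congr (if _ then _ else _); lia|lia|rewrite /dist; lia].
have padR1 c : (i.+1 < N)%N -> c = (if ((i == 0) || (i == N.-2))%N
    then (4 - 17 * sigma) / 16 else - sigma) -> pad N f i.+3 = 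
    c * ((i.+3%:R - 3 / 2) * (N%:R - (i.+3%:R - 3 / 2))).
  move=> h ->; apply: padE; first lia.
  by rewrite entry1; [congr (if _ then _ else _); lia|lia|rewrite /dist; lia].
have padC c : c = M_entry eps sigma N i.+1 i.+1 -> pad N f i.+2 = 
    c * ((i.+2%:R - 3 / 2) * (N%:R - (i.+2%:R - 3 / 2))).
  by move=> ->; apply: padE => //; lia.
have [e|[e|[e|[e|e]]]] :
    (i = 0 \/ i = 1 \/ (2 <= i /\ i.+2 < N) \/ N = i.+2 \/ N = i.+1)%N by lia.
- rewrite (pad0 i) ?(pad0 i.+1); [|lia..].
  rewrite (padC ((31 * sigma + 8) / 16)); last by rewrite entry0 ifT //; lia.
  rewrite (padR1 ((4 - 17 * sigma) / 16)); [|lia|by rewrite ifT //; lia].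
  rewrite padR2; last lia.
  rewrite e.
  rewrite [X in 0 < X](_ : _ = (22 * sigma + 56) / 64); [lra|by field].
- rewrite (pad0 i); last lia.
  rewrite (padL1 ((4 - 17 * sigma) / 16)); [|lia|by rewrite ifT //; lia].
  rewrite (padC ((23 * sigma + 8) / 16)); last by rewrite entry0 ifF ?ifT //; lia.
  rewrite (padR1 (- sigma)); [|lia|by rewrite ifF //; lia].
  rewrite padR2; last lia.
  rewrite e.
  rewrite [X in 0 < X](_ : _ = (14 * sigma + 120) / 64); [lra|by field].
- rewrite padL2; last lia.
  rewrite (padL1 (- sigma)); [|lia|by rewrite ifF //; lia].
  rewrite (padC ((24 * sigma + 8) / 16)); last by rewrite entry0 !ifF //; lia.
  rewrite (padR1 (- sigma)); [|lia|by rewrite ifF //; lia].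
  rewrite padR2; last lia.
  rewrite -!natr1.
  rewrite [X in 0 < X](_ : _ = 2); [lra|by field].
- rewrite padL2; last lia.
  rewrite (padL1 (- sigma)); [|lia|by rewrite ifF //; lia].
  rewrite (padC ((23 * sigma + 8) / 16)); last by rewrite entry0 ifF ?ifT //; lia.
  rewrite (padR1 ((4 - 17 * sigma) / 16)); [|lia|by rewrite ifT //; lia].
  rewrite (pad0 i.+4); last lia.
  rewrite e -!natr1.
  rewrite [X in 0 < X](_ : _ = (14 * sigma + 120) / 64); [lra|by field].
- rewrite padL2; last lia.
  rewrite (padL1 ((4 - 17 * sigma) / 16)); [|lia|by rewrite ifT //; lia].
  rewrite (padC ((31 * sigma + 8) / 16)); last by rewrite entry0 ifT //; lia.
  rewrite (pad0 i.+3) ?(pad0 i.+4); [|lia..].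
  rewrite e -!natr1.
  rewrite [X in 0 < X](_ : _ = (22 * sigma + 56) / 64); [lra|by field].
Qed.

Theorem theorem9p7 (R : realType) (N : nat) (h eps sigma : R)
    (hN : (7 <= N)%N) (hh : 0 < h)
    (hse : sigma + eps = 1)
    (hs1 : 1 < sigma)
    (hs2 : sigma <= 104 * Num.sqrt 2 / 79 - 12 / 79) :
  monotone_mx (TM_mx eps sigma N) /\ monotone_mx (T_mx h eps sigma N).
Proof.
have hD := sigma_bound _ _ hs1 hs2.
have hs := sigma_lt2 _ _ hs1 hD.
have hTM : monotone_mx (TM_mx eps sigma N).
  rewrite TM_penta ?hs1 //; apply: penta_monotone; [lra|lra|lra|nra].
split=> //; apply: monotone_scale; first by rewrite invr_gt0.
apply: (monotone_comparison _ _ _ _ (\col_(j < N) parabola N j) hTM) => [i j|i|i].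
- by rewrite mxE M_entry_le_TM.
- by rewrite mxE parabola_gt0.
- rewrite mxE.
  have := M_parabola_gt0 _ eps sigma N i hN hse hs1 (ltn_ord i).
  by congr (_ < _); apply: eq_bigr => j _; rewrite !mxE.
Qed.
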